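(* Let $q$ be a prime power and let $l=(q-3)q^0+(q-3)q^1$. Then $$g_{l+q^2,\,q}=3S_1^{q-4}-6S_2S_1^{q-5}$$ and $$g_{l+2q^2,\,q}=-S_1^{q-3}+6S_2S_1^{q-4}-6S_2^2S_1^{q-5}.$$
   Context: For a prime power $q$ (a power of the prime $p$) and an integer $n\ge 0$, $g_{n,q}\in\mathbb{F}_p[X]$ denotes the unique polynomial satisfying $\sum_{a\in\mathbb{F}_q}(X+a)^n=g_{n,q}(X^q-X)$. Here $S_1=X$ and $S_2=X+X^q$.
   Formalization: For q = 2 the printed formulas fail (l = -3, g_{1,2} = 1 but the right side is S_1^{-2}); here q-3, q-4, q-5 are read as 0 when negative, so q = 2 becomes a different, true identity with l = 0. For q ≥ 3 nothing changes. *)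

(* Defs.v *)
From HB Require Import structures.
From mathcomp Require Import all_boot all_order all_fingroup all_algebra.
From mathcomp Require Import all_solvable all_field.
From mathcomp Require Import zify.

Set Implicit Arguments.
Unset Strict Implicit.
Unset Printing Implicit Defensive.

Import GRing.Theory.
Local Open Scope ring_scope.

(* Elements of 'F_p are represented by naturals below p, so the inclusion of
   the prime subfield into F is the canonical cast nat -> F. *)
Definition Fp_incl (p : nat) (F : finFieldType) (pcharF : p \in [pchar F])
  (a : 'F_p) : F := (nat_of_ord a)%:R.

Section FpIncl.
Variables (p : nat) (F : finFieldType) (pcharF : p \in [pchar F]).

Lemma Fp_incl_nat m : Fp_incl pcharF m%:R = m%:R.
Proof.
rewrite /Fp_incl val_Fp_nat ?(pcharf_prime pcharF) // [in RHS](divn_eq m p).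
by rewrite natrD natrM (pcharf0 pcharF) mulr0 add0r.
Qed.

Lemma Fp_natP (a : 'F_p) : exists m : nat, a = m%:R.
Proof. by exists (nat_of_ord a); rewrite natr_Zp. Qed.

Fact Fp_incl_zmod : zmod_morphism (Fp_incl pcharF).
Proof.
move=> a b; apply/eqP; rewrite eq_sym subr_eq; apply/eqP.
have [[c cE] [d dE]] := (Fp_natP (a - b), Fp_natP b).
by rewrite -[a in LHS](subrK b) cE dE -natrD !Fp_incl_nat natrD.
Qed.

Fact Fp_incl_monoid : monoid_morphism (Fp_incl pcharF).
Proof.
split=> [|a b]; first exact: (Fp_incl_nat 1).
have [[c ->] [d ->]] := (Fp_natP a, Fp_natP b).
by rewrite -natrM !Fp_incl_nat natrM.
Qed.

HB.instance Definition _ :=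
  GRing.isZmodMorphism.Build 'F_p F (Fp_incl pcharF) Fp_incl_zmod.
HB.instance Definition _ :=
  GRing.isMonoidMorphism.Build 'F_p F (Fp_incl pcharF) Fp_incl_monoid.

End FpIncl.

Definition g_spec (p : nat) (F : finFieldType) (pcharF : p \in [pchar F])
    (n : nat) (g : {poly 'F_p}) : bool :=
  \sum_(a : F) ('X + a%:P) ^+ n
    == map_poly (Fp_incl pcharF) g \Po ('X^#|F| - 'X).

Section GPoly.
Variables (p : nat) (F : finFieldType) (pcharF : p \in [pchar F]).

Lemma g_unique n g1 g2 : g_spec pcharF n g1 -> g_spec pcharF n g2 -> g1 = g2.
Proof.
rewrite /g_spec => /eqP-> /eqP eq12; apply/eqP; rewrite -subr_eq0.
have sizeY : size ('X^#|F| - 'X : {poly F}) = #|F|.+1.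
  rewrite size_polyDl ?size_polyXn // size_polyN size_polyX ltnS.
  exact: finNzRing_gt1.
rewrite -(map_poly_eq0 (Fp_incl pcharF)).
rewrite -(@comp_poly_eq0 _ _ ('X^#|F| - 'X)); last first.
  by rewrite sizeY ltnS ltnW ?finNzRing_gt1.
by rewrite rmorphB comp_polyB /= subr_eq0 eq12.
Qed.

Lemma power_sum_Fp n :
  exists m : 'F_p, \sum_(a : F) a ^+ n = Fp_incl pcharF m.
Proof.
have [/existsP[u /andP[u0 un]] | un1] :=
  boolP [exists u : F, (u != 0) && (u ^+ n != 1)].
  exists 0; rewrite rmorph0; apply/eqP; set s := \sum_a _.
  have /eqP: s * u ^+ n = s.
    rewrite mulr_suml [RHS](reindex_inj (mulIf u0)) /=.
    by apply: eq_bigr => a _; rewrite exprMn.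
  rewrite -subr_eq0 -[X in _ - X]mulr1 -mulrBr mulf_eq0 subr_eq0 (negPf un).
  by rewrite orbF.
exists (\sum_(a : F) ((a != 0) || (n == 0%N))%:R).
rewrite rmorph_sum; apply: eq_bigr => a _; rewrite rmorph_nat.
have [-> | a0] := eqVneq a 0; first by rewrite expr0n.
by move/existsPn/(_ a): un1; rewrite a0 negbK => /eqP.
Qed.

Lemma g_exists n : exists g, g_spec pcharF n g.
Proof.
elim/ltn_ind: n => n IHn; have q_gt1 : (1 < #|F|)%N := finNzRing_gt1 F.
have [le_q_n | lt_n_q] := leqP #|F| n.
  have [|g1 /eqP g1P] := IHn (n - #|F|)%N; first by move: q_gt1 le_q_n; move: #|F| => q; lia.
  have [|g2 /eqP g2P] := IHn (n - #|F|).+1; first by move: q_gt1 le_q_n; move: #|F| => q; lia.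
  exists (g1 * 'X + g2); rewrite /g_spec rmorphD rmorphM /= map_polyX.
  rewrite comp_polyD comp_polyM comp_polyX -g1P -g2P mulr_suml -big_split /=.
  apply/eqP/eq_bigr => a _.
  rewrite -[in LHS](subnK le_q_n) exprD exprSr -mulrDr; congr (_ * _).
  have pq : [pchar {poly F}].-nat #|F|.
    rewrite (eq_pnat _ (pchar_poly F)) (eq_pnat _ (pcharf_eq pcharF)).
    by have /abelem_pgroup := fin_ring_pchar_abelem pcharF; rewrite /pgroup cardsT.
  by rewrite exprDn_pchar // -polyC_exp expf_card addrA subrK.
have [m sumE] := power_sum_Fp n; exists m%:P.
rewrite /g_spec map_polyC comp_polyC /= -sumE -subr_eq0.
apply/negPn/negP => nz.
have := max_poly_roots nz (rs := enum F); rewrite enum_uniq -cardE.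
rewrite ltnNge => /(_ _ isT)/negP; apply.
  apply/allP=> b _; rewrite rootE !hornerE horner_sum subr_eq0; apply/eqP.
  rewrite [RHS](reindex_inj (addrI b)) /=; apply: eq_bigr => a _.
  by rewrite !hornerE.
apply: (leq_trans (size_polyD _ _)); rewrite geq_max size_polyN.
rewrite (leq_trans (size_polyC_leq1 _) (ltnW q_gt1)) andbT.
apply: (leq_trans (size_sum _ _ _)); apply/bigmax_leqP => a _.
by apply: (leq_trans (size_poly_exp_leq _ _)); rewrite size_XaddC mul1n.
Qed.

End GPoly.

(* The polynomial g_{n,q}, q = #|F|; well defined by g_exists and g_unique. *)
Definition g_poly (p : nat) (F : finFieldType) (pcharF : p \in [pchar F])
  (n : nat) : {poly 'F_p} := xchoose (g_exists pcharF n).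

Lemma g_polyP (p : nat) (F : finFieldType) (pcharF : p \in [pchar F]) (n : nat) :
  \sum_(a : F) ('X + a%:P) ^+ n
    = map_poly (Fp_incl pcharF) (g_poly pcharF n) \Po ('X^#|F| - 'X).
Proof. exact/eqP/(xchooseP (g_exists pcharF n)). Qed.

Lemma g_polyE (p : nat) (F : finFieldType) (pcharF : p \in [pchar F]) (n : nat)
    (g : {poly 'F_p}) :
  \sum_(a : F) ('X + a%:P) ^+ n
    = map_poly (Fp_incl pcharF) g \Po ('X^#|F| - 'X) ->
  g_poly pcharF n = g.
Proof. by move=> /eqP; apply: g_unique (xchooseP (g_exists pcharF n)). Qed.

(* S1 and S2 are raised to exponents q - 3, q - 4, q - 5 truncated at 0.  For
   q >= 3 nothing changes: whenever such an exponent would be negative, its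
   coefficient vanishes in 'F_p (3 = 6 = 0 for q = 3, and 6 = 0 for q = 4). *)
Definition S1 (p : nat) : {poly 'F_p} := 'X.
Definition S2 (p q : nat) : {poly 'F_p} := 'X + 'X^q.

(* Main.v *)
(** Put [u := X + a], [Y := X^q - X].  Then [u^q = u + Y] and
    [u^(q^2) = u + Y + Y^q], so the sums to compute are the sums over [u] of
    [P(u)] with [P(T) = T^(q-3) (T + Y)^(q-3) (T + S_2)^k].  By [u^q = u + Y],
    the power sums of the [u] of exponent at most [2q - 3] all vanish, except
    the one of exponent [q - 1], which is [-1]; hence the sum of the [P(u)] is
    minus the coefficient of [T^2] in [(T + Y)^(q-3) (T + S_2)^k].  For [q = 2]
    the exponents [q - 3] are truncated and [l = 0]; there [u^(2 q^2) = u^(q^3)],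
    and both sums over [u] equal [-1]. *)
Require Import Defs.
From mathcomp Require Import all_boot all_order all_algebra all_field.
From mathcomp Require Import fingroup abelian pgroup zify ring.
Import GRing.Theory.
Local Open Scope ring_scope.

Lemma coef_XaddC_exp (R : comNzRingType) (c : R) (n i : nat) :
  (('X + c%:P) ^+ n)`_i = c ^+ (n - i) *+ 'C(n, i).
Proof.
rewrite addrC exprDn coef_sum.
have [le_i_n | lt_n_i] := leqP i n; last first.
  rewrite bin_small // big1 // => j _.
  rewrite coefMn -polyC_exp coefCM coefXn gtn_eqF ?mulr0 ?mul0rn //.
  by rewrite (leq_trans (ltn_ord j)).
rewrite (bigD1 (inord i)) //= inordK ?ltnS // coefMn -polyC_exp coefCM coefXn.
rewrite eqxx mulr1 big1 ?addr0 // => j; rewrite -val_eqE /= inordK ?ltnS //.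
by move=> ji; rewrite coefMn -polyC_exp coefCM coefXn eq_sym (negPf ji) mulr0 mul0rn.
Qed.

(** Serves the case [k = 1], with [R] the ring [{poly F}], [n = q - 3], [c = Y] and [s = Y + Y^q],
    the value of [S2] at [Y]. *)
Lemma coef2_XaddC_exp_mul (R : comNzRingType) (c s : R) (n : nat) :
  (('X + c%:P) ^+ n * ('X + s%:P))`_2
    = c ^+ (n - 1) * n%:R + c ^+ (n - 2) * ('C(n, 2))%:R * s.
Proof.
by rewrite mulrDr coefD coefMX coefMC !coef_XaddC_exp bin1 !mulr_natr.
Qed.

Lemma coef2_XaddC_exp_mul_sqr (R : comNzRingType) (c s : R) (n : nat) :
  (('X + c%:P) ^+ n * ('X + s%:P) ^+ 2)`_2
    = c ^+ n + c ^+ (n - 1) * n%:R * s *+ 2 + c ^+ (n - 2) * ('C(n, 2))%:R * s ^+ 2.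
Proof.
rewrite expr2 mulrA [_ * ('X + _)]mulrDr coefD coefMX coefMC coef2_XaddC_exp_mul.
rewrite [_ * ('X + _)]mulrDr coefD coefMX coefMC !coef_XaddC_exp /=.
by rewrite bin0 bin1 subn0 mulr1n mulr_natr; ring.
Qed.

Section PowerSums.
Variable F : finFieldType.
Local Notation q := #|F|.

(** Translation by 1 permutes [F], while it adds [q] to the sum of all elements. *)
Lemma natr_card_finField : q%:R = 0 :> F.
Proof.
apply: (addrI (\sum_(a : F) a)); rewrite addr0 -sumr_const -big_split /=.
by rewrite [RHS](reindex_inj (addIr 1)).
Qed.

(** If [u != 0] and [u^n != 1], scaling by [u] multiplies the sum by [u^n] and also fixes it, so it
    is 0. Without such a [u], all [q] elements would be roots of [X^(n+1) - X], of degree below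
    [q]. *)
Lemma sum_expf_eq0 (n : nat) : (n < q.-1)%N -> \sum_(a : F) a ^+ n = 0.
Proof.
have q_gt1 := finNzRing_gt1 F; move=> lt_n_q.
have [-> | n_gt0] := posnP n.
  by under eq_bigr do rewrite expr0; rewrite sumr_const natr_card_finField.
have [/existsP[u /andP[u0 un]] | un1] :=
  boolP [exists u : F, (u != 0) && (u ^+ n != 1)].
  set s := \sum_a _; apply/eqP.
  have /eqP: s * u ^+ n = s.
    rewrite mulr_suml [RHS](reindex_inj (mulIf u0)) /=.
    by apply: eq_bigr => a _; rewrite exprMn.
  rewrite -subr_eq0 -[X in _ - X]mulr1 -mulrBr mulf_eq0 subr_eq0 (negPf un).
  by rewrite orbF => ->.
have nz : 'X^(n.+1) - 'X != 0 :> {poly F}.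
  rewrite subr_eq0; apply/eqP => /(congr1 (fun r : {poly F} => size r)).
  by rewrite size_polyXn size_polyX; lia.
have := max_poly_roots nz (rs := enum F); rewrite enum_uniq -cardE.
rewrite size_polyDl ?size_polyN ?size_polyX ?size_polyXn ?ltnS // => roots_lt.
suff : (q < n.+2)%N by move: lt_n_q q_gt1; move: q => q0; lia.
apply: roots_lt => //; apply/allP => a _; rewrite rootE !hornerE subr_eq0 exprSr.
have [-> | a0] := eqVneq a 0; first by rewrite mulr0.
by move/existsPn/(_ a): un1; rewrite a0 negbK => /eqP->; rewrite mul1r.
Qed.

Lemma sum_expf_card_pred : \sum_(a : F) a ^+ q.-1 = -1.
Proof.
have q_gt1 := finNzRing_gt1 F.
have q_pred_gt0 : (0 < q.-1)%N by rewrite -subn1 subn_gt0.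
rewrite (bigD1 0) //= expr0n gtn_eqF // add0r.
rewrite (eq_bigr (fun=> 1)) => [|a a0]; last first.
  by apply: (mulfI a0); rewrite -exprS prednK ?expf_card ?mulr1 // ltnW.
apply: (addrI 1); rewrite subrr -[RHS]natr_card_finField.
by rewrite -sumr_const [RHS](bigD1 0).
Qed.

Lemma exprD_card (x y : {poly F}) : (x + y) ^+ q = x ^+ q + y ^+ q.
Proof.
have [p p_pr charF] := finPcharP F.
apply: exprDn_pchar; rewrite (eq_pnat _ (pchar_poly F)) (eq_pnat _ (pcharf_eq charF)).
by have /abelem_pgroup := fin_ring_pchar_abelem charF; rewrite /pgroup cardsT.
Qed.

Local Notation Y := ('X^q - 'X : {poly F}).

Lemma exp_XaddC_card (a : F) : ('X + a%:P) ^+ q = 'X + a%:P + Y.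
Proof. by rewrite exprD_card -polyC_exp expf_card; ring. Qed.

Lemma exp_XaddC_card2 (a : F) :
  ('X + a%:P) ^+ (q ^ 2) = 'X + a%:P + (Y + Y ^+ q).
Proof. by rewrite -mulnn exprM exp_XaddC_card exprD_card exp_XaddC_card !addrA. Qed.

(** After binomial expansion, only the term [a^m] can survive: the lower powers of [a] have
    exponents below [q - 1]. *)
Lemma sum_XaddC_exp_lt_card (m : nat) : (m < q)%N ->
  \sum_(a : F) ('X + a%:P) ^+ m = - (m == q.-1)%:R :> {poly F}.
Proof.
move=> lt_m_q; under eq_bigr do rewrite exprDn.
rewrite exchange_big /= big_ord_recr /= big1 => [|i _]; last first.
  rewrite sumrMnl -mulr_sumr.
  under eq_bigr do rewrite -polyC_exp.
  rewrite -rmorph_sum /= sum_expf_eq0 ?mulr0 ?mul0rn //.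
  by move: (ltn_ord i) lt_m_q; move: q => q0; lia.
rewrite add0r subnn binn; under eq_bigr do rewrite mul1r mulr1n -polyC_exp.
rewrite -rmorph_sum; have [-> | m_neq] := eqVneq m q.-1.
  by rewrite sum_expf_card_pred rmorphN rmorph1.
rewrite sum_expf_eq0 ?rmorph0 ?oppr0 //.
by move: m_neq lt_m_q; move: q => q0; lia.
Qed.

(** For [m >= q], [u^m = u^(m-q+1) + u^(m-q) Y], and both exponents are below [q - 1]. *)
Lemma sum_XaddC_exp (m : nat) : (m + 2 < 2 * q)%N ->
  \sum_(a : F) ('X + a%:P) ^+ m = - (m == q.-1)%:R :> {poly F}.
Proof.
have q_gt1 := finNzRing_gt1 F; move=> lt_m_2q.
have [le_q_m | /sum_XaddC_exp_lt_card //] := leqP q m.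
rewrite -(subnK le_q_m).
under eq_bigr do rewrite exprD exp_XaddC_card mulrDr -exprSr.
have [lt_r lt_Sr] : (m - q < q.-1)%N /\ ((m - q).+1 < q.-1)%N.
  by move: q_gt1 le_q_m lt_m_2q; move: q => q0; lia.
have le_q : (q.-1 <= q)%N by exact: leq_pred.
rewrite big_split -mulr_suml /= sum_XaddC_exp_lt_card ?(leq_trans lt_Sr) //.
rewrite sum_XaddC_exp_lt_card ?(leq_trans lt_r) //.
rewrite (ltn_eqF lt_r) (ltn_eqF lt_Sr) oppr0 mul0r addr0 gtn_eqF ?oppr0 //.
by rewrite subnK // (leq_trans _ le_q_m) // prednK // ltnW.
Qed.

Lemma sum_horner_XaddC (P : {poly {poly F}}) : (size P + 1 < 2 * q)%N ->
  \sum_(a : F) P.['X + a%:P] = - P`_q.-1.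
Proof.
move=> sizeP; under eq_bigr do rewrite horner_coef.
rewrite exchange_big /=.
(* The indicator sum is empty of nonzero terms exactly when the index lies beyond [size P], where
   the coefficient defaults to 0. *)
have -> : P`_q.-1 = \sum_(i < size P) P`_i * (i == q.-1 :> nat)%:R.
  have [lt_q_P | le_P_q] := ltnP q.-1 (size P); last first.
    rewrite nth_default // big1 // => i _.
    by rewrite ltn_eqF ?mulr0 // (leq_trans (ltn_ord i)).
  rewrite (bigD1 (Ordinal lt_q_P)) //= eqxx mulr1 big1 ?addr0 // => i.
  by rewrite -val_eqE /= => /negPf->; rewrite mulr0.
rewrite -sumrN; apply: eq_bigr => i _.
rewrite -mulr_sumr sum_XaddC_exp ?mulrN //.
by apply: leq_ltn_trans sizeP; rewrite addn2 addn1 ltnS ltn_ord.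
Qed.

(* [C(q - 3, 2) = 6 + q (q - 7) / 2], where [p] divides [q / 2] even if [p = 2]
   since then [4] divides [q]. *)
Lemma natr_bin_card_sub3 : (2 < q)%N -> ('C(q - 3, 2))%:R = 6 :> F.
Proof.
move=> q_gt2; have q0 := natr_card_finField.
have [two0 | two_neq0] := eqVneq (2%:R : F) 0; last first.
  apply: (mulfI two_neq0); rewrite -natrM mul_bin_left bin1.
  (* At [q = 3] the factor [q - 4] is truncated; there both sides vanish, as [6 = 2q]. *)
  have [q3 | q_neq3] := eqVneq q 3.
    have -> : 6 = 2%:R * q%:R :> F by rewrite q3; ring.
    by rewrite q0 !mulr0 q3.
  have q_gt3 : (3 < q)%N by rewrite ltn_neqAle eq_sym q_neq3.
  rewrite natrM -subnDA !natrB // q0; ring.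
have charF : 2%N \in [pchar F] by rewrite inE /= two0 eqxx.
have /p_natP[k q_def] : 2%N.-nat q.
  have /abelem_pgroup := fin_ring_pchar_abelem charF.
  by rewrite /pgroup cardsT.
case: k q_def q_gt2 => [|[|k]] ->; rewrite ?expn0 ?expn1 // => _.
rewrite (_ : 6 = 2%:R * 3 :> F); last by ring.
(* Here [q - 4 = 4 (2^k - 1)], so halving leaves an even number. *)
have -> : 'C(2 ^ k.+2 - 3, 2) = (2 * ((2 ^ k.+2 - 3) * (2 ^ k - 1)))%N.
  have : (0 < 2 ^ k)%N by rewrite expn_gt0.
  have : (2 * 'C(2 ^ k.+2 - 3, 2) = (2 ^ k.+2 - 3) * (2 ^ k.+2 - 4))%N.
    by rewrite mul_bin_left bin1 mulnC -subnDA.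
  by rewrite !expnS; nia.
by rewrite natrM two0 !mul0r.
Qed.

Lemma sum_XaddC_exp_digits (k : nat) : (2 < q)%N -> (k <= 2)%N ->
  \sum_(a : F) ('X + a%:P) ^+ ((q - 3) * q ^ 0 + (q - 3) * q ^ 1 + k * q ^ 2)
    = - (('X + Y%:P) ^+ (q - 3) * ('X + (Y + Y ^+ q)%:P) ^+ k)`_2.
Proof.
move=> q_gt2 le_k_2; set Q := _ * _.
have sizeQ : (size Q <= q - 3 + k + 1)%N.
  apply: leq_trans (size_polyMleq _ _) _.
  have := size_poly_exp_leq ('X + Y%:P) (q - 3).
  have := size_poly_exp_leq ('X + (Y + Y ^+ q)%:P) k.
  by rewrite !size_XaddC !mul1n -subn1; lia.
(* The factor [T^(q-3)] shifts index 2 to [q - 1]; as [k <= 2], the degree stays at most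
   [2q - 4]. *)
have -> : Q`_2 = ('X^(q - 3) * Q)`_q.-1.
  rewrite coefXnM ifN; first by congr _`_ _; lia.
  by rewrite -leqNgt; lia.
rewrite -sum_horner_XaddC; last first.
  have := size_polyMleq 'X^(q - 3) Q; rewrite size_polyXn.
  by move: (size (_ * Q)) (size Q) sizeQ => s1 s2; lia.
apply: eq_bigr => a _; rewrite expn0 expn1 muln1 (mulnC (q - 3)%N) (mulnC k).
rewrite !exprD (exprM _ q) (exprM _ (q ^ 2)%N) exp_XaddC_card exp_XaddC_card2.
by rewrite /Q !hornerE.
Qed.

(** The constant [c] is counted [q = 0] times, and [u = u^(q-1)] sums to -1. *)
Lemma sum_XaddC_addC (c : {poly F}) : q = 2%N ->
  \sum_(a : F) ('X + a%:P + c) = -1.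
Proof.
move=> q2; rewrite big_split /= sumr_const -scaler_nat natr_card_finField scale0r.
rewrite (eq_bigr (fun a => ('X + a%:P) ^+ 1)) //.
by rewrite sum_XaddC_exp_lt_card q2 // addr0.
Qed.

End PowerSums.
Theorem lemma2p7 (p e q : nat) (F : finFieldType) (pcharF : p \in [pchar F])
    (q_def : q = (p ^ e)%N) (cardF : #|F| = q) :
  let l := ((q - 3) * q ^ 0 + (q - 3) * q ^ 1)%N in
  g_poly pcharF (l + q ^ 2)
    = 3 * S1 p ^+ (q - 4) - 6 * S2 p q * S1 p ^+ (q - 5)
  /\
  g_poly pcharF (l + 2 * q ^ 2)
    = - S1 p ^+ (q - 3) + 6 * S2 p q * S1 p ^+ (q - 4)
      - 6 * S2 p q ^+ 2 * S1 p ^+ (q - 5).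
Proof.
clear q_def; subst q => l; have q_gt1 := finNzRing_gt1 F.
(* [phi] embeds the coefficients and substitutes [Y], so each claim becomes an identity in
   [{poly F}]. *)
pose phi : {rmorphism {poly 'F_p} -> {poly F}} :=
  comp_poly ('X^#|F| - 'X) \o map_poly (Fp_incl pcharF).
have phiX : phi 'X = 'X^#|F| - 'X by rewrite /= map_polyX comp_polyX.
have phiE n g : \sum_a ('X + a%:P) ^+ n = phi g -> g_poly pcharF n = g.
  exact: g_polyE.
rewrite /S1 /S2; move: phi phiX phiE => phi phiX phiE.
have phi_morphE := (rmorph_nat phi, rmorphXn phi, rmorphN phi, rmorphD phi, rmorphM phi).
have [q_gt2 | q_le2] := ltnP 2 #|F|.
  have bin2E : ('C(#|F| - 3, 2))%:R = 6 :> {poly F}.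
    by rewrite -polyC_natr natr_bin_card_sub3 // polyC_natr.
  have natE : (#|F| - 3)%:R = - 3 :> {poly F}.
    by rewrite natrB // -polyC_natr natr_card_finField add0r.
  (* Truncated subtraction still gives [q - 3 - 1 = q - 4] and [q - 3 - 2 = q - 5], so [q = 3] and
     [q = 4] need no separate case. *)
  split; apply: phiE; rewrite !phi_morphE phiX.
    rewrite -[X in (_ + X)%N]mul1n sum_XaddC_exp_digits // expr1.
    by rewrite coef2_XaddC_exp_mul natE bin2E -!subnDA; ring.
  rewrite sum_XaddC_exp_digits // coef2_XaddC_exp_mul_sqr natE bin2E -!subnDA.
  by ring.
have q2 : #|F| = 2%N by apply/eqP; rewrite eqn_leq q_le2.
have two0 : 2%:R = 0 :> {poly F} by rewrite -q2 -polyC_natr natr_card_finField.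
have three_eqN1 : 3 = -1 :> {poly F}.
  by apply/eqP; rewrite -addr_eq0 natr1 (natrM _ 2 2) two0 mul0r.
have six_eq0 : 6 = 0 :> {poly F}.
  by rewrite (natrM _ 2 3) two0 mul0r.
have -> : l = 0%N by rewrite /l q2.
split; apply: phiE; rewrite !phi_morphE phiX add0n six_eq0 !mul0r.
  under eq_bigr do rewrite exp_XaddC_card2.
  by rewrite sum_XaddC_addC // three_eqN1 [in RHS]q2 expr0 subr0 mulr1.
(* The outer exponent 2 is read as [q], so that Frobenius turns [u^(2 q^2)] into [u] plus a constant
   independent of [a]. *)
under eq_bigr => a _.
  rewrite mulnC exprM exp_XaddC_card2 -[in X in _ ^+ X]q2 exprD_card.
  rewrite exp_XaddC_card -addrA; over.
by rewrite sum_XaddC_addC // [in RHS]q2 expr0 addr0 subr0.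
Qed.
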